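(* Let $n,m$ be positive integers. There exists a graph $G$ on $n$ vertices having a fooling set of size $m$ if and only if $\mathbf{bp}_{or}(K_m)\le n$.
   Context: For a graph $G$, a fooling set is a set $\mathcal C$ of pairs $(K,S)$ where $K$ is a clique and $S$ a stable set of $G$ (possibly empty) with $K\cap S=\emptyset$, such that for any two distinct pairs $(K,S),(K',S')\in\mathcal C$, $K\cap S'\neq\emptyset$ or $K'\cap S\neq\emptyset$. $K_m$ is the complete graph on $m$ vertices. The oriented bipartite packing $\mathbf{bp}_{or}(H)$ of an undirected graph $H$ is the minimum $k$ such that there exist pairs $(A_1,B_1),\dots,(A_k,B_k)$ of disjoint vertex subsets of $H$ with every vertex of $A_i$ adjacent in $H$ to every vertex of $B_i$ (oriented complete bipartite subgraphs, oriented from $A_i$ to $B_i$), such that for every edge $xy$ of $H$ there is an $i$ with $x\in A_i,y\in B_i$ or $y\in A_i,x\in B_i$, and there is no ordered pair $(x,y)$ and distinct $i\neq j$ with $x\in A_i\cap A_j$ and $y\in B_i\cap B_j$ (each edge is covered at least once, and at most once in each direction). *)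

(* Defs.v *)
From mathcomp Require Import all_boot.

Set Implicit Arguments.
Unset Strict Implicit.
Unset Printing Implicit Defensive.

Record sgraph := SGraph {
  vertex :> finType;
  edge : rel vertex;
  edge_sym : symmetric edge;
  edge_irrefl : irreflexive edge }.

Definition complete_rel m : rel 'I_m := fun x y => x != y.

Lemma complete_sym m : symmetric (@complete_rel m).
Proof. by move=> x y; rewrite /complete_rel eq_sym. Qed.

Lemma complete_irrefl m : irreflexive (@complete_rel m).
Proof. by move=> x; rewrite /complete_rel eqxx. Qed.

Definition complete_graph (m : nat) : sgraph :=
  SGraph (@complete_sym m) (@complete_irrefl m).

Definition clique (G : sgraph) (K : {set G}) : bool :=
  [forall x in K, forall y in K, (x != y) ==> edge x y].

Definition stable (G : sgraph) (S : {set G}) : bool :=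
  [forall x in S, forall y in S, ~~ edge x y].

Definition fooling_set (G : sgraph) (C : {set {set G} * {set G}}) : bool :=
  [forall p in C, [&& clique p.1, stable p.2 & [disjoint p.1 & p.2]]] &&
  [forall p in C, forall q in C, (p != q) ==>
     ((p.1 :&: q.2 != set0) || (q.1 :&: p.2 != set0))].

(* [f i] is the pair (A_i, B_i); the parts may be empty. *)
Definition or_packing (H : sgraph) (k : nat)
    (f : {ffun 'I_k -> {set H} * {set H}}) : bool :=
  [&& [forall i, [disjoint (f i).1 & (f i).2]],
      [forall i, forall x in (f i).1, forall y in (f i).2, edge x y],
      [forall x : H, forall y : H, edge x y ==>
         [exists i, ((x \in (f i).1) && (y \in (f i).2))
                 || ((y \in (f i).1) && (x \in (f i).2))]]
    & [forall x : H, forall y : H, forall i, forall j, (i != j) ==>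
         ~~ [&& x \in (f i).1, x \in (f j).1, y \in (f i).2 & y \in (f j).2]]].

Definition has_or_packing (H : sgraph) (k : nat) : bool :=
  [exists f : {ffun 'I_k -> {set H} * {set H}}, or_packing f].

(* Orienting every edge both ways, as single arcs, gives a packing. *)
Lemma ex_or_packing (H : sgraph) : exists k, has_or_packing H k.
Proof.
pose E := [set p : H * H | edge p.1 p.2].
exists #|E|; apply/existsP.
exists [ffun i : 'I_#|E| => ([set (enum_val i).1], [set (enum_val i).2])].
have EP (i : 'I_#|E|) : edge (enum_val i).1 (enum_val i).2.
  by have := enum_valP i; rewrite inE.
apply/and4P; split.
- apply/forallP=> i; rewrite ffunE /= disjoints1 inE.
  by apply/eqP=> e; have := EP i; rewrite e edge_irrefl.
- apply/forallP=> i; rewrite ffunE /=; apply/forall_inP=> x /set1P ->.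
  by apply/forall_inP=> y /set1P ->.
- apply/forallP=> x; apply/forallP=> y; apply/implyP=> xy.
  have xyE : (x, y) \in E by rewrite inE.
  apply/existsP; exists (enum_rank_in xyE (x, y)).
  by rewrite ffunE /= enum_rankK_in // !inE !eqxx.
- apply/forallP=> x; apply/forallP=> y; apply/forallP=> i; apply/forallP=> j.
  apply/implyP=> /eqP nij; rewrite !ffunE /= !inE; apply/negP.
  case/and4P=> /eqP xi /eqP xj /eqP yi /eqP yj; apply: nij; apply: enum_val_inj.
  by rewrite [LHS]surjective_pairing [RHS]surjective_pairing -xi -xj -yi -yj.
Qed.

Definition bp_or (H : sgraph) : nat := ex_minn (ex_or_packing H).

(* Main.v *)
Require Import Defs.
From mathcomp Require Import all_boot.

(** Indexing a packing of [K_m] by the vertices [v] of [G] and a fooling set by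
    ['I_m], the two objects are transposes of each other: [i] is in [A_v] iff
    [v] is in [K_i], and [i] is in [B_v] iff [v] is in [S_i]. Covering the edge
    [ij] is the fooling condition for [i] and [j]; covering no arc twice says
    that a [K_i] and an [S_j] share at most one vertex. The latter holds for a
    clique and a stable set, and conversely it makes every [S_j] stable in the
    graph obtained by joining vertices that lie in a common [K_i]. *)

(* Disjointness of [A i] and [B i] is implied by the first clause, as [edge] is
   irreflexive. *)
Definition packing_family (H : sgraph) (I : finType) (A B : I -> {set H}) : Prop :=
  [/\ forall i x y, x \in A i -> y \in B i -> edge x y,
      forall x y, edge x y -> exists i,
        (x \in A i) && (y \in B i) || (y \in A i) && (x \in B i)
    & forall x y i j, x \in A i -> x \in A j -> y \in B i -> y \in B j -> i = j].

Lemma has_or_packingP (H : sgraph) (k : nat) :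
  reflect (exists A B : 'I_k -> {set H}, packing_family H 'I_k A B)
          (has_or_packing H k).
Proof.
apply: (iffP existsP) => [[f /and4P[_ adj cov once]]|[A [B [adj cov once]]]].
  exists (fun i => (f i).1), (fun i => (f i).2); split.
  - by move=> i x y xA yB; move/forallP/(_ i)/forall_inP/(_ x xA)/forall_inP: adj; apply.
  - move=> x y xy; apply/existsP.
    by move/forallP/(_ x)/forallP/(_ y)/implyP: cov; apply.
  - move=> x y i j xi xj yi yj; apply/eqP/negPn/negP => nij.
    move/forallP/(_ x)/forallP/(_ y)/forallP/(_ i)/forallP/(_ j)/implyP: once.
    by move/(_ nij); rewrite xi xj yi yj.
exists [ffun i => (A i, B i)]; apply/and4P; split; apply/forallP.
- move=> i; rewrite ffunE disjoint_subset; apply/subsetP => x xA.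
  by rewrite inE; apply/negP => /(adj _ _ _ xA); rewrite edge_irrefl.
- move=> i; rewrite ffunE; apply/forall_inP => x xA; apply/forall_inP => y.
  exact: adj xA.
- move=> x; apply/forallP => y; apply/implyP => /cov[i xyi].
  by apply/existsP; exists i; rewrite ffunE.
- move=> x; apply/forallP => y; apply/forallP => i; apply/forallP => j.
  apply/implyP => /eqP nij; rewrite !ffunE; apply/negP.
  by case/and4P => xi xj yi yj; apply: nij; apply: (once x y).
Qed.

(** Each pair goes to the position given by the rank of its index, and the positions that are left
    over receive empty pairs. This serves both for indexing by the vertices of a graph and for
    lengthening an optimal packing. *)
Lemma packing_family_has (H : sgraph) (I : finType) (A B : I -> {set H}) (k : nat) :
  packing_family H I A B -> #|I| <= k -> has_or_packing H k.
Proof.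
case=> adj cov once Ik; apply/has_or_packingP.
pose pad (F : I -> {set H}) (i : 'I_k) :=
  [set x | [exists v, (enum_rank v == i :> nat) && (x \in F v)]].
have padP (F : I -> {set H}) (i : 'I_k) x : reflect (exists2 v, enum_rank v = i :> nat & x \in F v)
                          (x \in pad F i).
  rewrite inE; apply: (iffP existsP) => [[v /andP[/eqP]]|[v /eqP vi xv]].
    by exists v.
  by exists v; rewrite vi.
have rank_inj (v w : I) : enum_rank v = enum_rank w :> nat -> v = w.
  by move/val_inj/enum_rank_inj.
exists (pad A), (pad B); split.
- move=> i x y /padP[v vi xv] /padP[w wi yw].
  by move: yw; rewrite -(rank_inj v w) ?vi ?wi //; apply: adj.
- move=> x y /cov[v xyv].
  pose i := widen_ord Ik (enum_rank v); exists i.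
  have padv (F : I -> {set H}) z : z \in F v -> z \in pad F i.
    by move=> zv; apply/padP; exists v.
  by case/orP: xyv => /andP[/padv-> /padv->]; rewrite ?orbT.
- move=> x y i j /padP[v vi xv] /padP[w wj xw] /padP[v' v'i yv] /padP[w' w'j yw].
  apply: val_inj; rewrite /= -vi -wj; congr (nat_of_ord (enum_rank _)).
  (* Both parts at one position come from the same index, since ranks are injective; so [once] for
     the original family applies. *)
  have ev : v' = v by apply: rank_inj; rewrite vi.
  have ew : w' = w by apply: rank_inj; rewrite wj.
  by move: yv yw; rewrite ev ew; apply: once xv xw.
Qed.

(** Minimality gives one direction; for the other, an optimal packing is padded with empty pairs up
    to length [k]. *)
Lemma bp_or_leP (H : sgraph) (k : nat) : reflect (has_or_packing H k) (bp_or H <= k).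
Proof.
rewrite /bp_or; case: ex_minnP => b packb minb.
apply: (iffP idP) => [bk|/minb //].
have /has_or_packingP[A [B AB]] := packb.
by apply: packing_family_has AB _; rewrite card_ord.
Qed.

Lemma fooling_set_packing (G : sgraph) (C : {set {set G} * {set G}}) :
  fooling_set C -> has_or_packing (complete_graph #|C|) #|G|.
Proof.
case/andP => /forall_inP CP /forall_inP foolC.
pose A (v : G) : {set complete_graph #|C|} := [set i : 'I_#|C| | v \in (enum_val i).1].
pose B (v : G) : {set complete_graph #|C|} := [set i : 'I_#|C| | v \in (enum_val i).2].
apply: (@packing_family_has _ _ A B) => //; split.
(* If [i = j], then [v] would lie in both the clique and the stable set of one pair, which are
   disjoint. *)
- move=> v i j; rewrite !inE => iv jv; apply/eqP => ij.
  have /and3P[_ _ /disjointFr/(_ iv)] := CP _ (enum_valP i).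
  by rewrite ij jv.
- move=> i j ij; have /forall_inP/(_ _ (enum_valP j))/implyP := foolC _ (enum_valP i).
  rewrite (inj_eq enum_val_inj) => /(_ ij).
  by case/orP => /set0Pn[v /setIP[vK vS]]; exists v; rewrite !inE vK vS ?orbT.
(* Distinct [u] and [v] would be adjacent in the clique of pair [i] and non-adjacent in the stable
   set of pair [j]. *)
- move=> i j u v; rewrite !inE => uK vK uS vS; apply/eqP/negPn/negP => uv.
  have /and3P[/forall_inP/(_ _ uK)/forall_inP/(_ _ vK)/implyP/(_ uv) euv _ _] :=
    CP _ (enum_valP i).
  have /and3P[_ /forall_inP/(_ _ uS)/forall_inP/(_ _ vS) + _] := CP _ (enum_valP j).
  by rewrite euv.
Qed.

(** By transposition, an element of [A u :&: A v] is an index [i] with both [u] and [v] in [K i];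
    thus every [K i] becomes a clique. *)
Definition common_rel (H : sgraph) (n : nat) (A : 'I_n -> {set H}) : rel 'I_n :=
  fun u v => (u != v) && (A u :&: A v != set0).

Lemma common_sym (H : sgraph) (n : nat) (A : 'I_n -> {set H}) :
  symmetric (common_rel H n A).
Proof. by move=> u v; rewrite /common_rel eq_sym setIC. Qed.

Lemma common_irrefl (H : sgraph) (n : nat) (A : 'I_n -> {set H}) :
  irreflexive (common_rel H n A).
Proof. by move=> u; rewrite /common_rel eqxx. Qed.

Definition common_graph (H : sgraph) (n : nat) (A : 'I_n -> {set H}) : sgraph :=
  SGraph (common_sym H n A) (common_irrefl H n A).

Lemma packing_fooling_set (m n : nat) (A B : 'I_n -> {set complete_graph m}) :
  packing_family (complete_graph m) 'I_n A B ->
  exists C : {set {set common_graph _ n A} * {set common_graph _ n A}},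
    fooling_set C /\ #|C| = m.
Proof.
case=> adj cov once.
pose G := common_graph _ n A.
pose K (i : 'I_m) : {set G} := [set v : 'I_n | i \in A v].
pose S (i : 'I_m) : {set G} := [set v : 'I_n | i \in B v].
have KS i : [disjoint K i & S i].
  rewrite disjoint_subset; apply/subsetP => v; rewrite !inE => iA.
  by apply/negP => /(adj _ _ _ iA); rewrite edge_irrefl.
have fool i j : i != j -> (K i :&: S j != set0) || (K j :&: S i != set0).
  case/(cov i j) => v /orP[] /andP[vK vS]; apply/orP; [left|right];
  by apply/set0Pn; exists v; rewrite !inE vK.
(* This makes the number of pairs exactly [m]: if distinct [i] and [j] gave the same pair, the
   fooling condition would make [K i] meet [S i]. *)
have KS_inj : injective (fun i => (K i, S i)).
  move=> i j [eK eS]; apply/eqP/negPn/negP => /fool.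
  by rewrite -eK -eS orbb setI_eq0 KS.
exists [set (K i, S i) | i : 'I_m]; split; last by rewrite card_imset ?card_ord.
apply/andP; split.
  apply/forall_inP => _ /imsetP[i _ ->]; apply/and3P; split; last exact: KS.
    apply/forall_inP => u uK; apply/forall_inP => v vK; apply/implyP => uv.
    rewrite !inE in uK vK.
    by apply/andP; split=> //; apply/set0Pn; exists i; rewrite inE uK.
  apply/forall_inP => u uS; apply/forall_inP => v vS; rewrite !inE in uS vS.
  (* If [u] and [v] in [S i] were adjacent through a common [K j], the arc from [j] to [i] would be
     covered by both [u] and [v]. *)
  apply/negP => /andP[/eqP uv /set0Pn[j /setIP[ju jv]]].
  by apply: uv; apply: once ju jv uS vS.
apply/forall_inP => _ /imsetP[i _ ->]; apply/forall_inP => _ /imsetP[j _ ->].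
apply/implyP => ij; apply: fool.
by apply: contraNneq ij => ->.
Qed.

Theorem theorem14 (n m : nat) (n_gt0 : 0 < n) (m_gt0 : 0 < m) :
  (exists G : sgraph, #|G| = n /\
     exists C : {set {set G} * {set G}}, fooling_set C /\ #|C| = m)
  <-> bp_or (complete_graph m) <= n.
Proof.
split=> [[G [<- [C [foolC <-]]]]|/bp_or_leP/has_or_packingP[A [B AB]]].
  by apply/bp_or_leP/fooling_set_packing.
exists (common_graph _ n A); split; first exact: card_ord.
exact: packing_fooling_set AB.
Qed.
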